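(* Let $T$ be a moon polyomino with $s$ rows and $t$ columns, $\mathbf{m}=(m_1,\dots,m_s)$ a tuple of nonnegative integers and $A\subseteq[t]$. The map $\Psi$ is a bijection from $\mathcal{N}^c(T,\mathbf{m};A)$ onto $\mathcal{C}_{m_1+1}(h_1-m_1)\times\cdots\times\mathcal{C}_{m_s+1}(h_s-m_s)$. Moreover, if $F\in\mathcal{N}^c(T,\mathbf{m};A)$, $\Psi(F)=(\mathrm{c}^{(1)},\dots,\mathrm{c}^{(s)})$ with $\mathrm{c}^{(i)}=(\mathrm{c}^{(i)}_1,\dots,\mathrm{c}^{(i)}_{m_i+1})$, and $ce$ is the cell of $R_i$ containing the $j$-th $1$ of $R_i$ from the left ($1\le j\le m_i$), then $$\mathrm{luc}(ce;F)=\mathrm{c}^{(i)}_1+\cdots+\mathrm{c}^{(i)}_j,\qquad \mathrm{ruc}(ce;F)=\mathrm{c}^{(i)}_{j+1}+\cdots+\mathrm{c}^{(i)}_{m_i+1}.$$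
   Context: A moon polyomino is a finite set of unit cells of the integer grid that is convex (every row and column of cells is a contiguous segment) and intersection-free (for any two rows, the set of horizontal positions of one contains that of the other; equivalently for columns). Rows $R_1,\dots,R_s$ labelled top to bottom, columns $C_1,\dots,C_t$ left to right; $r_i$ is the number of cells of $R_i$. Let $i_0$ be the largest index with $r_{i_0}=\max_i r_i$; $Up(T)=\{R_i:i\le i_0\}$, $Low(T)=\{R_i:i>i_0\}$. Order: $R_i\prec R_j$ iff $r_i<r_j$, or $r_i=r_j$ with $R_i\in Up(T)$, $R_j\in Low(T)$, or $r_i=r_j$, both in $Up(T)$, $i<j$, or $r_i=r_j$, both in $Low(T)$, $i>j$. If $R_{i_1}\prec\cdots\prec R_{i_s}$, set $h_{i_u}=r_{i_u}-(m_{i_1}+\cdots+m_{i_{u-1}})-a_{i_u}$, where $a_{i_u}$ is the number of $k\in A$ with $C_k$ intersecting $R_{i_u}$. $\mathcal{N}^c(T,\mathbf{m};A)$ is the set of $01$-fillings of $T$ with at most one $1$ per column, exactly $m_i$ ones in $R_i$, and whose set of indices of all-zero columns is $A$. $\mathcal{C}_k(N)$ is the set of $k$-tuples of nonnegative integers with sum $N$ (empty if $N<0$). The $i$-th rectangle of $T$ is the largest rectangle of cells in $T$ whose top row is $R_i$ if $R_i\in Up(T)$, or whose bottom row is $R_i$ if $R_i\in Low(T)$. Coloring of $F$: color all cells of columns containing no $1$; for each $i$ and each $1$-cell $x$ of $R_i$, color the cells of the $i$-th rectangle in the column of $x$ strictly below $x$ (if $R_i\in Up(T)$) or strictly above $x$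 (if $R_i\in Low(T)$). For a $1$-cell $c$, $\mathrm{luc}(c;F)$ (resp. $\mathrm{ruc}(c;F)$) is the number of uncolored $0$-cells in the row of $c$ to its left (resp. right). $\Psi(F)=(\mathrm{c}^{(1)},\dots,\mathrm{c}^{(s)})$ where, if $m_i\ge1$, $\mathrm{c}^{(i)}_1$ is the number of uncolored cells of $R_i$ strictly left of its first $1$, $\mathrm{c}^{(i)}_{u+1}$ ($1\le u\le m_i-1$) the number strictly between its $u$-th and $(u+1)$-th $1$, and $\mathrm{c}^{(i)}_{m_i+1}$ the number strictly right of its last $1$; if $m_i=0$, $\mathrm{c}^{(i)}=(\text{number of uncolored cells of }R_i)$.
   Formalization: Assumes t−|A| ≤ m_1+…+m_s (else there is no filling, yet the product may be nonempty), and a 1 of R_i colors cells of its rectangle only in rows R_k with R_i ≺ R_k (matters only when a row of Low(T) has the length of a row of Up(T), where the claim fails as stated). *)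

(* Defs.v *)
From mathcomp Require Import all_boot all_order all_algebra.
Set Implicit Arguments.
Unset Strict Implicit.
Unset Printing Implicit Defensive.

(* Cells are pairs (row, column), rows numbered from the top and columns from
   the left, both from 0.  A set of cells S is used in two ways: as a polyomino,
   and as a 01-filling of a polyomino T (then S \subset T is the set of 1-cells,
   and the cells of T outside S contain 0). *)
Section MoonPolyominoes.
Variables s t : nat.
Notation cell := ('I_s * 'I_t)%type.
Implicit Types (T F S : {set cell}) (A : {set 'I_t}) (m : 'I_s -> nat).
Implicit Types (i k b : 'I_s) (j : 'I_t) (x y : cell).

(* A row is given by its column indices, a column by its row indices. *)
Definition row_of S i : {set 'I_t} := [set j | (i, j) \in S].
Definition col_of S j : {set 'I_s} := [set i | (i, j) \in S].

(* The first two clauses say that T has exactly s rows and t columns. *)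
Record moon_polyomino T : Prop := MoonPolyomino {
  moon_row_neq0 : forall i, row_of T i != set0;
  moon_col_neq0 : forall j, col_of T j != set0;
  moon_row_convex : forall i (j1 j2 j3 : 'I_t), j1 <= j2 <= j3 ->
    (i, j1) \in T -> (i, j3) \in T -> (i, j2) \in T;
  moon_col_convex : forall j (i1 i2 i3 : 'I_s), i1 <= i2 <= i3 ->
    (i1, j) \in T -> (i3, j) \in T -> (i2, j) \in T;
  moon_intersection_free : forall i k,
    row_of T i \subset row_of T k \/ row_of T k \subset row_of T i
}.

Definition rlen T i : nat := #|row_of T i|.

(* The largest index of a row of maximal length (0 if s = 0). *)
Definition last_longest T : nat :=
  \max_(i < s | [forall k, rlen T k <= rlen T i]) i.

Definition up T i : bool := i <= last_longest T.

Definition prec T i k : bool :=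
  (rlen T i < rlen T k) ||
  (rlen T i == rlen T k) &&
    [|| up T i && ~~ up T k,
        [&& up T i, up T k & i < k]
      | [&& ~~ up T i, ~~ up T k & k < i]].

(* h_i; since prec is a strict total order, the rows listed before R_i in
   increasing order are the R_k with k prec i. *)
Definition h T m A i : int :=
  ((rlen T i)%:Z - (\sum_(k | prec T k i) m k)%N%:Z
     - #|[set j in A | j \in row_of T i]|%:Z)%R.

(* N^c(T, m; A) *)
Definition Nc T m A : {set {set cell}} :=
  [set F : {set cell} |
    [&& F \subset T,
        [forall j, #|col_of F j| <= 1],
        [forall i, #|row_of F i| == m i]
      & [set j | col_of F j == set0] == A]].

(* C_k(N), k-tuples being sequences of length k *)
Definition Ck (k : nat) (N : int) : pred (seq nat) :=
  [pred c : seq nat | (size c == k) && ((sumn c)%:Z == N)%R].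

(* C_{m_1+1}(h_1-m_1) x ... x C_{m_s+1}(h_s-m_s).  A filling in Nc T m A has
   t - #|A| nonempty columns, hence as many 1s.  When the m_i sum to less than
   that, Nc T m A is empty but this product need not be: for s = t = 1, m = (0)
   and A empty it is {((1))}. *)
Definition Cprod T m A : pred {ffun 'I_s -> seq nat} :=
  [pred c : {ffun 'I_s -> seq nat} |
    [forall i, c i \in Ck (m i).+1 (h T m A i - (m i)%:Z)%R]].

(* The cells in the columns of R_i and in the rows between R_i and R_b. *)
Definition rect T i b : {set cell} :=
  [set x : cell | (minn i b <= x.1 <= maxn i b) && (x.2 \in row_of T i)].

(* The i-th rectangle. *)
Definition ith_rect T i : {set cell} :=
  if up T i
  then rect T i [arg max_(b > i | (i <= b) && (rect T i b \subset T)) b]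
  else rect T i [arg min_(b < i | (b <= i) && (rect T i b \subset T)) b].

(* The cells of the rectangle of the row of x that are in the column of x and
   strictly below x (upper rows) or strictly above x (lower rows). *)
Definition shadow T x : {set cell} :=
  [set y in ith_rect T x.1 | (y.2 == x.2) &&
     (if up T x.1 then x.1 < y.1 else y.1 < x.1)].

(* A 1 of R_i only colors cells of rows larger than R_i for prec.  By
   prec_shadow below, this changes the coloring only when a row of Low(T) has
   the same length as a row of Up(T): without it two such rows would color each
   other's cells, and the numbers of uncolored cells would not match h. *)
Definition colored T F y : bool :=
  (col_of F y.2 == set0) ||
  [exists x in F, (y \in shadow T x) && prec T x.1 y.1].

Lemma prec_shadow T x y :
  (forall i k, up T i -> ~~ up T k -> rlen T i != rlen T k) ->
  y \in shadow T x -> prec T x.1 y.1.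
Proof.
move=> noties; rewrite !inE => /andP[yR /andP[_ yx]].
suff sub: row_of T x.1 \subset row_of T y.1.
  rewrite /prec; have := subset_leq_card sub; rewrite leq_eqVlt.
  case/predU1P => [e|->//]; rewrite /rlen e ltnn eqxx /=.
  case: (boolP (up T x.1)) yx => ux yx; case: (boolP (up T y.1)) => uy //=.
  - by rewrite yx.
  - by have := noties _ _ uy ux; rewrite /rlen e eqxx.
apply/subsetP => j jx; rewrite inE; move: yR; rewrite /ith_rect.
case: ifP => ux.
  case: arg_maxnP => [|b /andP[_ /subsetP bT] _].
    rewrite leqnn; apply/subsetP => -[k l]; rewrite !inE /= minnn maxnn -eqn_leq.
    by move=> /andP[/eqP/val_inj <-].
  by rewrite inE => /andP[yb _]; apply: bT; rewrite inE /= yb jx.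
case: arg_minnP => [|b /andP[_ /subsetP bT] _].
  rewrite leqnn; apply/subsetP => -[k l]; rewrite !inE /= minnn maxnn -eqn_leq.
  by move=> /andP[/eqP/val_inj <-].
by rewrite inE => /andP[yb _]; apply: bT; rewrite inE /= yb jx.
Qed.

Definition uncolored T F y : bool := (y \in T) && ~~ colored T F y.

Definition luc T F x : nat :=
  #|[set y : cell | [&& y.1 == x.1, y.2 < x.2, y \notin F & uncolored T F y]]|.

Definition ruc T F x : nat :=
  #|[set y : cell | [&& y.1 == x.1, x.2 < y.2, y \notin F & uncolored T F y]]|.

(* Columns of the 1s of R_i, from left to right (enum is increasing on 'I_t). *)
Definition ones F i : seq nat := [seq val j | j <- enum (row_of F i)].

(* The number of uncolored cells of R_i strictly between its u-th and (u+1)-th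
   1, the 1s being counted from 1; there is no left bound if u = 0 and no right
   bound if u is the number of 1s in R_i. *)
Definition gap T F i (u : nat) : nat :=
  #|[set j : 'I_t | [&& uncolored T F (i, j),
       (0 < u) ==> (nth 0 (ones F i) u.-1 < j)
     & (u < size (ones F i)) ==> (j < nth 0 (ones F i) u)]]|.

(* The entry c^(i)_u is nth 0 (Psi T F i) u.-1. *)
Definition Psi T F : {ffun 'I_s -> seq nat} :=
  [ffun i => mkseq (gap T F i) (size (ones F i)).+1].

End MoonPolyominoes.

(* Main.v *)
Require Import Defs.
From mathcomp Require Import all_boot all_order all_algebra zify.

(* If R_k precedes R_i then R_k is contained in R_i (as a set of columns), and a
   1 of R_k colors the cell of R_i in its column.  Hence the uncolored cells of
   R_i are those in the columns that are neither in A nor occupied by a 1 of an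
   earlier row, and there are h_i of them.  Filling the rows in increasing order
   thus amounts to choosing, at each step, m_i of h_i available cells, and such
   a choice is the same as the sequence of the m_i + 1 gaps it leaves.  Every
   such sequence occurs because there are as many m_i-subsets of an h_i-set as
   sequences of m_i + 1 natural numbers with sum h_i - m_i.  At the end no column
   outside A is left empty, because there are at least t - #|A| ones, in distinct
   columns outside A. *)

Set Implicit Arguments.
Unset Strict Implicit.
Unset Printing Implicit Defensive.

(** * Subsets of a finite linear order and the gaps they leave *)

Section Gaps.
Variable t : nat.
Implicit Types (U B : {set 'I_t}) (b x : 'I_t).

(** The bound [p] is a natural number so that [x.+1] is allowed even when [x] is the last column. *)
Definition below B (p : nat) : nat := #|[set b in B | b < p]|.

(** A point outside [B] is in the gap numbered [u] (from 0) when exactly [u] points of [B] precede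
    it; this form needs no separate treatment of the two outer gaps. *)
Definition gapcount U B (u : nat) : nat :=
  #|[set x in U :\: B | below B x == u]|.

Definition gaps U B : seq nat := mkseq (gapcount U B) #|B|.+1.

Lemma sorted_ones B : sorted ltn [seq val b | b <- enum B].
Proof.
apply: (@subseq_sorted _ _ ltn_trans _ (iota 0 t)); last exact: iota_ltn_sorted.
by rewrite -val_enum_ord map_subseq // enumT filter_subseq.
Qed.

(** In an increasing list the entries smaller than [p] form an initial segment. *)
Lemma nth_sorted_ltn (l : seq nat) v p : sorted ltn l -> v < size l ->
  (nth 0 l v < p) = (v < count (fun q => q < p) l).
Proof.
elim: l v => //= a l IH v.
rewrite (path_sortedE ltn_trans) => /andP[/allP al sl].
have count0 : p <= a -> count (fun q => q < p) l = 0.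
  move=> pa; apply/eqP; rewrite -leqn0 leqNgt -has_count.
  by apply/hasPn => q /al /= aq; lia.
have [ap|pa] := ltnP a p; case: v => [|v] //= vl; rewrite ?ap ?add1n ?ltnS ?IH //.
  by rewrite count0 // ltnNge pa.
by rewrite count0.
Qed.

Lemma nth_ltn_below B v p : v < #|B| ->
  (nth 0 [seq val b | b <- enum B] v < p) = (v < below B p).
Proof.
move=> vB; rewrite nth_sorted_ltn ?sorted_ones ?size_map -?cardE // count_map.
rewrite /below cardE -(size_filter (fun b : 'I_t => b < p)) /enum_mem -filter_predI.
by congr (_ < size _); apply: eq_filter => x; rewrite /= !inE andbC.
Qed.

Lemma below_le_card B p : below B p <= #|B|.
Proof. by apply: subset_leq_card; apply/subsetP => x; rewrite inE => /andP[]. Qed.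

Lemma leq_below B p q : p <= q -> below B p <= below B q.
Proof.
move=> pq; apply: subset_leq_card; apply/subsetP => x; rewrite !inE => /andP[-> xp].
exact: leq_trans pq.
Qed.

Lemma belowS B x : below B x.+1 = (x \in B) + below B x.
Proof.
rewrite /below (cardsD1 x) inE ltnSn andbT; congr (_ + _).
by apply: eq_card => y; rewrite !inE ltnS (ltn_neqAle y) -val_eqE andbCA.
Qed.

Lemma ltn_below B b p : b \in B -> b < p -> below B b < below B p.
Proof. by move=> bB bp; have := leq_below B bp; rewrite belowS bB. Qed.

Lemma below_surj B v : v < #|B| -> exists2 b, b \in B & below B b = v.
Proof.
move=> vB; have vs : v < size [seq val b | b <- enum B] by rewrite size_map -cardE.
have /mapP[b bB eb] := mem_nth 0 vs; rewrite mem_enum in bB.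
(* With [b] the entry at position [v], the bound [b] gives [below B b <= v] and the bound [b.+1]
   gives the reverse inequality. *)
have := nth_ltn_below b vB; have := nth_ltn_below b.+1 vB.
by rewrite eb belowS bB ltnn ltnSn; exists b => //; lia.
Qed.

Lemma gap_cond B u x : u <= #|B| ->
  let l := [seq val b | b <- enum B] in
  ((0 < u) ==> (nth 0 l u.-1 < x)) && ((u < size l) ==> (x < nth 0 l u))
    = (x \notin B) && (below B x == u).
Proof.
move=> uB /=; rewrite size_map -cardE.
(* This bound stands in for the right-hand condition, which is void when [u = #|B|]. *)
have xB : below B x.+1 <= #|B| := below_le_card _ _; rewrite belowS in xB.
have -> : ((0 < u) ==> (nth 0 [seq val b | b <- enum B] u.-1 < x)) = (u <= below B x).
  by case: u uB => [|u] uB //=; rewrite nth_ltn_below.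
have -> : ((u < #|B|) ==> (x < nth 0 [seq val b | b <- enum B] u))
          = ((u < #|B|) ==> (below B x.+1 <= u)).
  case: ltnP => // u_lt; rewrite !implyTb [RHS]leqNgt -nth_ltn_below // ltnS.
  by rewrite -ltnNge.
rewrite belowS; case: (x \in B) xB => xB; lia.
Qed.

(** Double counting: each [x] outside [B] contributes only at the index [u = below B x]. *)
Lemma sum_gapcount U B (a c : nat) : \sum_(a <= u < c) gapcount U B u =
  #|[set x in U :\: B | a <= below B x < c]|.
Proof.
have cardP (P : pred nat) : #|[set x in U :\: B | P (below B x)]| =
    \sum_(x in U :\: B) P (below B x).
  rewrite -sum1_card (eq_bigl (fun x => (x \in U :\: B) && P (below B x))).
    by rewrite big_mkcondr; apply: eq_bigr => x _; case: (P _).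
  by move=> x; rewrite inE.
rewrite (eq_bigr (fun u => \sum_(x in U :\: B) (below B x == u))); last first.
  by move=> u _; apply: (cardP (pred1 u)).
rewrite exchange_big (cardP (fun v => a <= v < c)).
apply: eq_bigr => x _; rewrite -mem_index_iota -count_uniq_mem ?iota_uniq //.
rewrite -sum1_count [RHS]big_mkcond; apply: eq_bigr => u _ /=.
by rewrite eq_sym; case: eqP.
Qed.

Lemma sumn_gaps U B : B \subset U -> sumn (gaps U B) + #|B| = #|U|.
Proof.
move=> BU; rewrite /gaps /mkseq sumnE big_map.
have := sum_gapcount U B 0 #|B|.+1; rewrite /index_iota subn0 => ->.
rewrite -(cardsID B U) (setIidPr BU) addnC; congr (_ + _).
by apply: eq_card => x; rewrite !inE leq0n ltnS below_le_card !andbT.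
Qed.

(** Going past [b] raises the count by one, so a point outside [B] is left of [b] exactly when at
    most [below B b] points of [B] precede it. *)
Lemma sum_gaps_left U B b : b \in B ->
  \sum_(0 <= u < (below B b).+1) gapcount U B u = #|[set x in U :\: B | x < b]|.
Proof.
move=> bB; rewrite sum_gapcount; apply: eq_card => x; rewrite !inE /= ltnS.
case: (boolP (x \in B)) => //= xB; congr (_ && _); case: (ltngtP x b) => [xb|bx|e].
- by rewrite leq_below // ltnW.
- by rewrite leqNgt ltn_below.
- by rewrite -(val_inj e) (negbTE xB) in bB.
Qed.

Lemma sum_gaps_right U B b : b \in B ->
  \sum_((below B b).+1 <= u < #|B|.+1) gapcount U B u =
  #|[set x in U :\: B | b < x]|.
Proof.
move=> bB; rewrite sum_gapcount; apply: eq_card => x; rewrite !inE.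
rewrite ltnS below_le_card andbT.
case: (boolP (x \in B)) => //= xB; congr (_ && _); case: (ltngtP x b) => [xb|bx|e].
- by rewrite ltnNge leq_below // ltnW.
- by rewrite ltn_below.
- by rewrite -(val_inj e) (negbTE xB) in bB.
Qed.

Lemma below_gaps U B b : B \subset U -> b \in B ->
  below U b = below B b + \sum_(0 <= u < (below B b).+1) gapcount U B u.
Proof.
move=> BU bB; rewrite sum_gaps_left // /below -(cardsID B); congr (_ + _).
  apply: eq_card => x; rewrite !inE; case: (boolP (x \in B)); last by rewrite andbF.
  by move/(subsetP BU) ->; rewrite andbT.
by apply: eq_card => x; rewrite !inE andbA.
Qed.

Lemma nth_gaps U B u : u <= #|B| -> nth 0 (gaps U B) u = gapcount U B u.
Proof. by move=> uB; rewrite nth_mkseq. Qed.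

(** By [below_gaps] the gaps determine the position in [U] of each point of [B], and the position
    determines the point. *)
Lemma gaps_inj U B B' : B \subset U -> B' \subset U ->
  gaps U B = gaps U B' -> B = B'.
Proof.
move=> BU BU' eg.
have eB : #|B| = #|B'|.
  by have := congr1 size eg; rewrite !size_mkseq => -[].
apply/eqP; rewrite eqEcard eB leqnn andbT; apply/subsetP => b bB.
have vB := ltn_below bB (ltn_ord b).
have vB' : below B b < #|B'| by rewrite -eB (leq_trans vB) ?below_le_card.
(* [b'] has the same index in [B'] as [b] has in [B]. *)
have [b' bB' eb] := below_surj vB'.
have e : below U b = below U b'.
  rewrite (below_gaps BU bB) (below_gaps BU' bB') eb; congr (_ + _).
  apply: eq_big_nat => u /andP[_ ub]; rewrite -!nth_gaps ?eg //; lia.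
suff -> : b = b' by [].
have [bU bU'] : b \in U /\ b' \in U by rewrite (subsetP BU) ?(subsetP BU').
apply: val_inj; case: (ltngtP b b') => // lt_b.
- by have := ltn_below bU lt_b; rewrite e ltnn.
- by have := ltn_below bU' lt_b; rewrite e ltnn.
Qed.

Lemma gaps_surj U (c : seq nat) k : size c = k.+1 -> sumn c + k = #|U| ->
  exists2 B : {set 'I_t}, B \subset U /\ #|B| = k & gaps U B = c.
Proof.
move=> sc ec; set n := sumn c.
(* Bounding the entries by [n] makes the target finite; [inord] loses nothing, since no gap exceeds
   the total [n] ([le_n] below). *)
pose g B : k.+1.-tuple 'I_n.+1 := [tuple inord (gapcount U B i) | i < k.+1].
pose D := [set B : {set 'I_t} | B \subset U & #|B| == k].
pose E := [set p : k.+1.-tuple 'I_n.+1 | \sum_(i <- p) i == n].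
have gE B : B \in D -> map val (g B) = gaps U B.
  rewrite inE => /andP[BU /eqP eB].
  have le_n u : gapcount U B u <= n.
    rewrite -(leq_add2r k) /n ec -(cardsID B U) (setIidPr BU) eB addnC leq_add2l.
    by apply: subset_leq_card; apply/subsetP => x; rewrite inE => /andP[].
  rewrite /gaps /mkseq eB -val_enum_ord -map_comp -[LHS]map_comp /=.
  by apply: eq_map => i /=; rewrite inordK ?ltnS.
have sumE (p : k.+1.-tuple 'I_n.+1) : \sum_(i <- p) i = sumn (map val p).
  by rewrite sumnE big_map.
(* [g] is injective on [D] and maps it into [E], and both sets have ['C(k + n, k)] elements. *)
have gD : g @: D = E.
  apply/eqP; rewrite eqEcard card_in_imset.
    rewrite /D cards_draws card_ord_partitions -ec addnC leqnn andbT.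
    apply/subsetP => p /imsetP[B BD ->]; rewrite inE sumE gE //.
    move: BD; rewrite inE => /andP[BU /eqP eB].
    by have := sumn_gaps BU; rewrite eB -ec -/n => /addIn ->.
  move=> B B' BD BD' eg; have := congr1 (map val \o val) eg => /=.
  rewrite !gE //; move: BD BD'; rewrite !inE => /andP[? _] /andP[? _].
  exact: gaps_inj.
have sP : size (map (@inord n) c) == k.+1 by rewrite size_map sc.
have cE : map val (Tuple sP) = c.
  rewrite /= -map_comp -[RHS]map_id; apply/eq_in_map => q qc /=.
  rewrite inordK // ltnS /n; elim: (c) qc => //= a l IH.
  by rewrite inE => /orP[/eqP->|/IH]; lia.
have : Tuple sP \in g @: D by rewrite gD inE sumE cE.
case/imsetP => B BD eB; exists B; last by rewrite -gE // -eB cE.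
by move: BD; rewrite inE => /andP[? /eqP].
Qed.

End Gaps.

(** * The row order of a moon polyomino and the cells that a 1 colors *)

Section Coloring.
Variables s t : nat.
Implicit Types (T F : {set 'I_s * 'I_t}) (A : {set 'I_t}) (m : 'I_s -> nat).
Implicit Types (B : 'I_s -> {set 'I_t}) (i k b : 'I_s) (j : 'I_t).

Lemma prec_irr T i : prec T i i = false.
Proof. by rewrite /prec !ltnn eqxx !andbF /= andbN. Qed.

Lemma prec_trans T : transitive (prec T).
Proof. rewrite /prec => k i b; case: (up T i); case: (up T k); case: (up T b); lia. Qed.

Lemma prec_total T i k : i != k -> prec T i k || prec T k i.
Proof. rewrite -val_eqE /prec; case: (up T i); case: (up T k) => /=; lia. Qed.

(** The row [i] witnesses that the maximum defining [last_longest] ranges over a nonempty set. *)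
Lemma last_longestP T i :
  exists2 b, val b = last_longest T & forall k, rlen T k <= rlen T b.
Proof.
pose P := [pred i | [forall k, rlen T k <= rlen T i]].
have P0 : P [arg max_(b > i) rlen T b].
  by apply/forallP => k; case: arg_maxnP => // b _; apply.
rewrite /last_longest (bigmax_eq_arg _ P0).
case: arg_maxnP => // b /forallP bP _; by exists b.
Qed.

(** Rows are comparable; the opposite inclusion would force equal lengths, hence equal rows. *)
Lemma row_subset_prec T i k : moon_polyomino T -> prec T k i ->
  row_of T k \subset row_of T i.
Proof.
move=> moonT ki; case: (moon_intersection_free moonT k i) => // sub.
have := subset_leq_card sub; rewrite -!/(rlen T _) => le_ik.
have e : rlen T i = rlen T k by move: ki; rewrite /prec; lia.
by have /eqP-> : row_of T i == row_of T k by rewrite eqEcard sub -!/(rlen T _) e leqnn.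
Qed.

(** A longest row contains every other row, so each column of [R_i] also meets [R_b] and, by
    convexity, every row in between. *)
Lemma rlen_unimodal T i k b : moon_polyomino T -> val b = last_longest T ->
  (forall k', rlen T k' <= rlen T b) ->
  (i <= k <= b) || (b <= k <= i) -> rlen T i <= rlen T k.
Proof.
move=> moonT eb bP ikb; apply: subset_leq_card; apply/subsetP => j.
rewrite !inE => ij.
have bj : (b, j) \in T.
  have : j \in row_of T b.
    case: (moon_intersection_free moonT i b) => sub.
      by rewrite (subsetP sub) ?inE.
    have /eqP-> : row_of T b == row_of T i by rewrite eqEcard sub -!/(rlen T _) bP.
    by rewrite inE.
  by rewrite inE.
by case/orP: ikb => ikb; apply: (moon_col_convex moonT ikb).
Qed.

(** Otherwise [R_k] would lie between [R_i] and the longest row; unimodality then leaves only a tie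
    in length, which [prec] breaks in favor of [R_i]. *)
Lemma prec_side T i k : moon_polyomino T -> prec T k i ->
  if up T k then k < i else i < k.
Proof.
move=> moonT ki; have [b eb bP] := last_longestP T i.
have := @rlen_unimodal T i k b moonT eb bP.
move: ki; rewrite /prec /up -eb; have : rlen T i <= rlen T b by [].
by case: (leqP k b) => kb; case: (leqP i b) => ib /=; lia.
Qed.

Lemma rect_prec T i k : moon_polyomino T -> prec T k i -> rect T k i \subset T.
Proof.
move=> moonT ki; apply/subsetP => -[b l]; rewrite inE /= => /andP[kbi kl].
have il := subsetP (row_subset_prec moonT ki) _ kl; rewrite !inE in kl il.
have [ik|ik] := leqP i k.
  by apply: (@moon_col_convex _ _ _ moonT l i b k) => //; lia.
by apply: (@moon_col_convex _ _ _ moonT l k b i) => //; lia.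
Qed.

Lemma prec_in_shadow T i k j : moon_polyomino T -> (k, j) \in T -> prec T k i ->
  (i, j) \in shadow T (k, j).
Proof.
move=> moonT kj ki; have := prec_side moonT ki; have := rect_prec moonT ki.
have rkk : rect T k k \subset T.
  apply/subsetP => -[l j']; rewrite !inE /= minnn maxnn -eqn_leq.
  by move=> /andP[/eqP/val_inj <-].
rewrite /shadow inE /= eqxx /ith_rect; case: (up T k) => rki ltk; rewrite ltk andbT.
  (* The rectangle from [R_k] to [R_i] lies in [T], so the extremal row [c] is at least as far from
     [R_k] as [R_i]. *)
  case: arg_maxnP => [|c _ /(_ i) cP]; first by rewrite leqnn.
  by have := cP; rewrite (ltnW ltk) rki !inE kj /= andbT => /(_ isT); lia.
case: arg_minnP => [|c _ /(_ i) cP]; first by rewrite leqnn.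
by have := cP; rewrite (ltnW ltk) rki !inE kj /= andbT => /(_ isT); lia.
Qed.

(* If [B k] is the set of columns of the 1s of [R_k], these are the columns of
   the uncolored cells of [R_i]. *)
Definition avail T A B i : {set 'I_t} :=
  row_of T i :\: (A :|: \bigcup_(k | prec T k i) B k).

(** * Uncolored cells as available columns, and their number *)

Lemma NcP T m A F : F \in Nc T m A ->
  [/\ F \subset T, forall i k j, (i, j) \in F -> (k, j) \in F -> i = k,
      forall i, #|row_of F i| = m i & forall j, (j \in A) = (col_of F j == set0)].
Proof.
rewrite inE => /and4P[FT /forallP F1 /forallP Fm /eqP FA].
split=> // [i k j iF kF|i|j]; first 1 last.
- exact/eqP.
- by rewrite -FA inE.
by apply: (card_le1_eqP (F1 j)); rewrite inE.
Qed.

(** A 1 that colors a cell lies in its column and in an earlier row; conversely [prec_in_shadow]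
    makes each such 1 color it. *)
Lemma uncolored_avail T m A F i j : moon_polyomino T -> F \in Nc T m A ->
  uncolored T F (i, j) = (j \in avail T A (row_of F) i).
Proof.
move=> moonT /NcP[FT F1 _ FA].
rewrite /uncolored /colored /= !inE -FA andbC; congr (_ && _); rewrite !negb_or.
congr (_ && _); congr (~~ _); apply/existsP/bigcupP => [[[k l]]|[k ki kj]].
  rewrite !inE /= => /and3P[kF /andP[_ /andP[/eqP e _]] ki].
  by exists k => //; rewrite inE e.
rewrite inE in kj; exists (k, j); rewrite kj ki prec_in_shadow //.
exact: (subsetP FT).
Qed.

Lemma row_sub_avail T m A F i : F \in Nc T m A ->
  row_of F i \subset avail T A (row_of F) i.
Proof.
move=> /NcP[FT F1 _ FA]; apply/subsetP => j; rewrite !inE => iF.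
rewrite (subsetP FT) // andbT negb_or FA; apply/andP; split.
  by apply/set0Pn; exists i; rewrite inE.
apply/bigcupP => -[k ki]; rewrite inE => kF.
by rewrite (F1 _ _ _ kF iF) prec_irr in ki.
Qed.

Lemma gap_gapcount T m A F i u : moon_polyomino T -> F \in Nc T m A ->
  u <= #|row_of F i| ->
  gap T F i u = gapcount (avail T A (row_of F) i) (row_of F i) u.
Proof.
move=> moonT FN uF; rewrite /gap /gapcount; apply: eq_card => j.
rewrite [LHS]in_set [RHS]in_set in_setD (uncolored_avail _ _ moonT FN).
by rewrite (gap_cond _ uF) andbCA andbA.
Qed.

Lemma Psi_gaps T m A F i : moon_polyomino T -> F \in Nc T m A ->
  Psi T F i = gaps (avail T A (row_of F) i) (row_of F i).
Proof.
move=> moonT FN; rewrite ffunE /gaps /ones size_map -cardE.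
by apply/eq_in_map => u; rewrite mem_iota add0n ltnS => /= uF;
  exact: (gap_gapcount moonT FN).
Qed.

Lemma card_bigcup_disjoint (P : pred 'I_s) B :
  (forall i k, P i -> P k -> i != k -> [disjoint B i & B k]) ->
  #|\bigcup_(i | P i) B i| = \sum_(i | P i) #|B i|.
Proof.
(* Indices outside [P] receive the empty set, so that all distinct indices give disjoint sets. *)
move=> disB; rewrite big_mkcond [RHS]big_mkcond -sum1_card.
rewrite partition_disjoint_bigcup => [|i k ik].
  by apply: eq_bigr => i _; rewrite sum1_card; case: (P i); rewrite ?cards0.
case: ifP => Pi; case: ifP => Pk; rewrite ?disB // -setI_eq0 ?set0I ?setI0 //.
Qed.

(** The later of the two rows avoids the columns used by the earlier one. *)
Lemma disjoint_avail T A B i k : i != k ->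
  B i \subset avail T A B i -> B k \subset avail T A B k -> [disjoint B i & B k].
Proof.
wlog ik : i k / prec T i k => [th ik Bi Bk|_ _ /subsetP Bk].
  case/orP: (prec_total T ik) => [/th->//|/th]; rewrite eq_sym disjoint_sym; exact.
apply/pred0P => j /=; apply/negbTE/negP => /andP[ji /Bk].
rewrite !inE negb_or => /andP[/andP[_ /bigcupP[]]]; by exists i.
Qed.

(** The columns used earlier lie in [R_i] and avoid [A], so the two subtractions in [h] are exact.
    Only rows before [R_i] are constrained, so the count also applies to partly built fillings. *)
Lemma card_avail T m A B i : moon_polyomino T ->
  (forall k, prec T k i -> B k \subset avail T A B k) ->
  (forall k, prec T k i -> #|B k| = m k) ->
  (#|avail T A B i|%:Z = h T m A i)%R.
Proof.
move=> moonT BA Bm; pose S := \bigcup_(k | prec T k i) B k.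
have SE : #|S| = \sum_(k | prec T k i) m k.
  rewrite card_bigcup_disjoint => [|k l ki li kl]; first exact: eq_bigr.
  by apply: (disjoint_avail kl); apply: BA.
have SR : S \subset row_of T i.
  apply/bigcupsP => k ki; apply: subset_trans (row_subset_prec moonT ki).
  by apply: subset_trans (BA k ki) _; rewrite subsetDl.
have SA : [disjoint S & A].
  rewrite -setI_eq0 setIC; apply/eqP; apply/setP => j; rewrite !inE.
  apply/negbTE/negP => /andP[jA /bigcupP[k ki /(subsetP (BA k ki))]].
  by rewrite !inE jA.
have e : #|avail T A B i| + (#|S| + #|[set j in A | j \in row_of T i]|) = rlen T i.
  rewrite -cardsUI [S :&: _](_ : _ = set0) ?cards0 ?addn0.
    rewrite addnC /rlen -(cardsID (A :|: S) (row_of T i)); congr (_ + _).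
    apply: eq_card => j; rewrite !inE; case: (boolP (j \in S)) => //=.
      by move/(subsetP SR); rewrite inE => ->; rewrite orbT.
    by rewrite orbF andbC.
  apply/setP => j; rewrite !inE; apply/negbTE/negP => /and3P[jS jA _].
  by have /pred0P/(_ j) := SA; rewrite /= jS jA.
rewrite /h -e -SE; lia.
Qed.

Lemma card_row_avail T m A F i : moon_polyomino T -> F \in Nc T m A ->
  (#|avail T A (row_of F) i|%:Z = h T m A i)%R.
Proof.
move=> moonT FN; apply: card_avail => // k _; first exact: row_sub_avail FN.
by case/NcP: FN.
Qed.

(** * Injectivity and surjectivity, by induction on the number of earlier rows *)

Definition rank T i := #|[set k | prec T k i]|.

Lemma rank_prec T i k : prec T k i -> rank T k < rank T i.
Proof.
move=> ki; apply: proper_card; apply/properP; split.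
  by apply/subsetP => l; rewrite !inE => /prec_trans; apply.
by exists k; rewrite !inE ?prec_irr.
Qed.

Lemma eq_avail T A B B' i : (forall k, prec T k i -> B k = B' k) ->
  avail T A B i = avail T A B' i.
Proof. by move=> e; rewrite /avail (eq_bigr _ e). Qed.

Lemma Psi_inj T m A F G : moon_polyomino T -> F \in Nc T m A -> G \in Nc T m A ->
  Psi T F = Psi T G -> F = G.
Proof.
move=> moonT FN GN eP.
have eFG i : row_of F i = row_of G i.
  have [n] := ubnP (rank T i); elim: n i => // n IH i ltn.
  (* Available columns depend on earlier rows only, where the fillings already agree. *)
  have eA : avail T A (row_of F) i = avail T A (row_of G) i.
    by apply: eq_avail => k /rank_prec ki; apply: IH; lia.
  apply: (@gaps_inj _ (avail T A (row_of F) i)).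
  - exact: row_sub_avail FN.
  - by rewrite eA; apply: row_sub_avail GN.
  - by rewrite -(Psi_gaps _ moonT FN) eP (Psi_gaps _ moonT GN) eA.
by apply/setP => -[i j]; have /setP/(_ j) := eFG i; rewrite !inE.
Qed.

Lemma rows_exist T m A (c : {ffun 'I_s -> seq nat}) n : moon_polyomino T ->
  c \in Cprod T m A -> exists B, forall i, rank T i < n ->
    [/\ B i \subset avail T A B i, #|B i| = m i & gaps (avail T A B i) (B i) = c i].
Proof.
move=> moonT /forallP cP; elim: n => [|n [B BP]]; first by exists (fun=> set0).
(* [D] supplies the rows of rank [n]; its other values are irrelevant. *)
have /fin_all_exists[D DP] i : exists D : {set 'I_t}, rank T i = n ->
    [/\ D \subset avail T A B i, #|D| = m i & gaps (avail T A B i) D = c i].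
  have [ri|ri] := eqVneq (rank T i) n; last by exists set0 => e; rewrite e eqxx in ri.
  have cA := card_avail moonT (B := B) (A := A) (m := m) (i := i).
  have {}cA : (#|avail T A B i|%:Z = h T m A i)%R.
    by apply: cA => k /rank_prec; rewrite ri => /BP[].
  have /andP[/eqP sc /eqP ec] := cP i.
  have [|D [? ?] ?] := @gaps_surj _ (avail T A B i) (c i) (m i) sc; last by exists D.
  lia.
exists (fun i => if rank T i < n then B i else D i) => i; rewrite ltnS => ri.
(* Rows before one of rank at most [n] have rank below [n], where the new family is still [B]. *)
have <- : avail T A B i = avail T A (fun i => if rank T i < n then B i else D i) i.
  by apply: eq_avail => k /rank_prec ki; rewrite (leq_trans ki).
by case: ltnP => [/BP //|nr]; apply: DP; apply/eqP; rewrite eqn_leq ri.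
Qed.

Lemma Psi_surj T m A (c : {ffun 'I_s -> seq nat}) : moon_polyomino T ->
  t - #|A| <= \sum_(i < s) m i -> c \in Cprod T m A ->
  exists F, F \in Nc T m A /\ Psi T F = c.
Proof.
move=> moonT le_t cP; have [B BP] := rows_exist #|'I_s|.+1 moonT cP.
have {}BP i := BP i (max_card _).
have BA i : B i \subset avail T A B i by case: (BP i).
pose F := [set x : 'I_s * 'I_t | x.2 \in B x.1].
have rowF i : row_of F i = B i by apply/setP => j; rewrite !inE.
have eqA i : avail T A (row_of F) i = avail T A B i by apply: eq_avail.
have disB i k : i != k -> [disjoint B i & B k].
  by move=> ik; apply: (disjoint_avail ik).
(* The [B i] are disjoint and avoid [A]; by [le_t] they have enough elements to fill its complement.
   Hence the empty columns are exactly those of [A]. *)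
have BCA : \bigcup_i B i = ~: A.
  apply/eqP; rewrite eqEcard; apply/andP; split.
    apply/bigcupsP => i _; apply: subset_trans (BA i) _; apply/subsetP => j.
    by rewrite !inE negb_or => /andP[/andP[]].
  rewrite card_bigcup_disjoint => [|i k _ _]; last exact: disB.
  rewrite (eq_bigr m) => [|i _]; last by case: (BP i).
  by rewrite cardsCs setCK card_ord.
have FN : F \in Nc T m A.
  rewrite inE; apply/and4P; split.
  - apply/subsetP => -[i j]; rewrite inE /= => /(subsetP (BA i)).
    by rewrite !inE => /andP[].
  - apply/forallP => j; apply/card_le1_eqP => i k; rewrite !inE /= => ij kj.
    apply/eqP; apply/negPn/negP => /disB/pred0P/(_ j); by rewrite /= ij kj.
  - by apply/forallP => i; rewrite rowF; case: (BP i) => _ ->.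
  - apply/eqP/setP => j; rewrite -[A]setCK -BCA !inE; apply: negbRL.
    apply/set0Pn/bigcupP => [[i]|[i _ ij]]; first by rewrite !inE; exists i.
    by exists i; rewrite !inE.
exists F; split=> //; apply/ffunP => i; rewrite (Psi_gaps _ moonT FN) eqA rowF.
by case: (BP i).
Qed.

Lemma Psi_Cprod T m A F : moon_polyomino T -> F \in Nc T m A ->
  Psi T F \in Cprod T m A.
Proof.
move=> moonT FN; apply/forallP => i.
rewrite (Psi_gaps _ moonT FN) inE size_mkseq.
have [_ _ Fm _] := NcP FN; rewrite Fm eqxx andTb.
have := sumn_gaps (row_sub_avail i FN); have := card_row_avail i moonT FN.
by rewrite Fm => <- <-; rewrite PoszD GRing.addrK.
Qed.

(** * Uncolored zeros to the left and to the right of a 1 *)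

Lemma card_row_cells T m A F i (P : pred 'I_t) : moon_polyomino T -> F \in Nc T m A ->
  #|[set y : 'I_s * 'I_t | [&& y.1 == i, P y.2, y \notin F & uncolored T F y]]| =
  #|[set j in avail T A (row_of F) i :\: row_of F i | P j]|.
Proof.
have inj : injective (fun j : 'I_t => (i, j)) by move=> j j' [].
move=> moonT FN; rewrite -(card_imset _ inj).
apply: eq_card => -[k j]; rewrite inE /=; apply/idP/imsetP.
  case/and4P=> /eqP-> Pj iF un; exists j => //; rewrite in_set Pj in_setD andbT.
  by rewrite -(uncolored_avail _ _ moonT FN) un inE iF.
case=> j'; rewrite in_set in_setD -(uncolored_avail _ _ moonT FN) inE.
by case/andP=> /andP[? ?] ? [-> ->]; apply/and4P.
Qed.

Lemma luc_ruc T m A F i (j : nat) (p : 'I_t) :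
  moon_polyomino T -> F \in Nc T m A -> 1 <= j <= m i ->
  p = nth 0 (ones F i) j.-1 :> nat ->
  luc T F (i, p) = \sum_(1 <= u < j.+1) nth 0 (Psi T F i) u.-1 /\
  ruc T F (i, p) = \sum_(j.+1 <= u < (m i).+2) nth 0 (Psi T F i) u.-1.
Proof.
move=> moonT FN /andP[j0 jm] pE; have [_ _ Fm _] := NcP FN.
have j_lt : j.-1 < #|row_of F i| by rewrite Fm prednK.
have pF : p \in row_of F i.
  rewrite -mem_enum -(mem_map val_inj) /= pE; apply: mem_nth.
  by rewrite size_map -cardE.
(* The [j]-th 1 has [j.-1] ones before it, so the gaps numbered [0] to [j.-1] are those on its
   left. *)
have pj : below (row_of F i) p = j.-1.
  have := nth_ltn_below p j_lt; have := nth_ltn_below p.+1 j_lt.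
  by rewrite -/(ones F i) -pE belowS pF ltnn ltnSn; lia.
rewrite (Psi_gaps _ moonT FN) /luc /ruc /=.
rewrite (card_row_cells _ (fun q => q < p) moonT FN).
rewrite (card_row_cells _ (fun q => p < q) moonT FN).
rewrite -sum_gaps_left // -sum_gaps_right // pj prednK // Fm.
split; rewrite big_add1 /=; apply: eq_big_nat => u uP; rewrite nth_gaps // Fm; lia.
Qed.

End Coloring.

Theorem theorem4p2 (s t : nat) (T : {set 'I_s * 'I_t}) (m : 'I_s -> nat)
    (A : {set 'I_t}) (moonT : moon_polyomino T)
    (le_t : t - #|A| <= \sum_(i < s) m i) :
  [/\ forall F, F \in Nc T m A -> Psi T F \in Cprod T m A,
      forall F G, F \in Nc T m A -> G \in Nc T m A ->
        Psi T F = Psi T G -> F = G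
    & forall c, c \in Cprod T m A ->
        exists F, F \in Nc T m A /\ Psi T F = c]
  /\
  forall F, F \in Nc T m A ->
    forall (i : 'I_s) (j : nat) (p : 'I_t), 1 <= j <= m i ->
      p = nth 0 (ones F i) j.-1 :> nat ->
      luc T F (i, p) = \sum_(1 <= u < j.+1) nth 0 (Psi T F i) u.-1 /\
      ruc T F (i, p) = \sum_(j.+1 <= u < (m i).+2) nth 0 (Psi T F i) u.-1.
Proof.
split; last by move=> F FN i j p; apply: luc_ruc FN.
split=> [F|F G|c].
- exact: Psi_Cprod.
- exact: Psi_inj.
- exact: Psi_surj.
Qed.
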